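(* Let $f\in\mathrm{Hol}(\alpha)$ be a normalized potential, i.e. $\mathscr L_f(1)=1$, and suppose that $f$ depends only on the first two coordinates. Let $\nu$ be the unique Borel probability measure on $X=E^{\mathbb N}$ with $\mathscr L_f^*\nu=\nu$, let $\pi_1:X\to E$ be the projection to the first coordinate, and let $P(x_1,A)=\mathscr L_f(1_A\circ\pi_1)(x)=\int_E 1_A(a)\,e^{f(ax)}\,dp(a)$ for $x=(x_1,x_2,\dots)\in X$ and $A\in\mathscr B(E)$ (which depends on $x$ only through $x_1$). Then $\pi=\nu\circ\pi_1^{-1}$ is an invariant measure for the transition probability kernel $P$, i.e. $$\int_E P(x_1,A)\,d\pi(x_1)=\pi(A)\qquad\text{for all }A\in\mathscr B(E).$$
   Context: $(E,d_E)$ is a complete separable metric space with its Borel sigma-algebra $\mathscr B(E)$ (a standard Borel space), $p$ is a fixed Borel probability measure on $E$, and $X=E^{\mathbb N}$ has metric $d_X(x,y)=\sum_{n\ge1}2^{-n}\min\{d_E(x_n,y_n),1\}$. $C_b(X,\mathbb R)$ is the space of bounded continuous real functions. For fixed $0<\alpha<1$, $\mathrm{Hol}(\alpha)=\{f\in C_b(X,\mathbb R):\sup_{x\ne y}|f(x)-f(y)|/d_X(x,y)^\alpha<\infty\}$. The Ruelle operator is $\mathscr L_f\varphi(x)=\int_Ee^{f(ax)}\varphi(ax)\,dp(a)$ with $ax=(a,x_1,x_2,\dots)$, for bounded measurable $\varphi$; its dual is given by $\int\varphi\,d[\mathscr L_f^*\mu]=\int\mathscr L_f\varphi\,d\mu$.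 *)

(* Defs.v *)
From HB Require Import structures.
From mathcomp Require Import all_boot all_order all_algebra.
From mathcomp Require Import all_classical all_reals all_analysis.
From mathcomp Require Import lra.

Set Implicit Arguments.
Unset Strict Implicit.
Unset Printing Implicit Defensive.

Import Order.TTheory GRing.Theory Num.Theory.
Import numFieldNormedType.Exports.

Local Open Scope classical_set_scope.
Local Open Scope ring_scope.

(* [Complete] already includes a distinguished point, which is also what
   [measurableType] requires; it is no restriction on a space that carries a
   probability measure. *)
#[short(type="completeMetricType")]
HB.structure Definition CompleteMetric (R : numDomainType) :=
  {T of CompletePseudoMetric R T & Metric R T}.

Definition separable (T : topologicalType) :=
  exists2 D : set T, countable D & dense D.

Definition borel (T : ptopologicalType) := g_sigma_algebraType (@open T).

HB.instance Definition _ (T : ptopologicalType) := Measurable.on (borel T).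

(* E^N; the coordinate x_n (n >= 1) of the usual notation is [x n.-1]. *)
Definition seqspace (E : Type) := nat -> E.

HB.instance Definition _ (E : choiceType) :=
  Choice.copy (seqspace E) (nat -> E).
HB.instance Definition _ (E : pointedType) :=
  Pointed.copy (seqspace E) (nat -> E).

Section seqspace_metric.
Context {R : realType} {E : metricType R}.
Implicit Types x y z : seqspace E.

Definition seqdist_term x y : R^nat :=
  fun n => 2^-1 ^+ n.+1 * Num.min (mdist (x n) (y n)) 1.

(* sum_(n >= 1) 2^-n min(d(x_n, y_n), 1) *)
Definition seqdist x y : R := limn (series (seqdist_term x y)).

Let seqdist_term_ge0 x y n : 0 <= seqdist_term x y n.
Proof.
by rewrite mulr_ge0// ?exprn_ge0 ?invr_ge0// le_min mdist_ge0 ler01.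
Qed.

Let is_cvg_seqdist x y : cvgn (series (seqdist_term x y)).
Proof.
apply: (@series_le_cvg _ _ (geometric 2^-1 2^-1)) => [//||n|].
- by move=> n; rewrite /geometric/= mulr_ge0// ?exprn_ge0 ?invr_ge0.
- by rewrite /geometric/= /seqdist_term exprS ler_piMr ?ge_min ?lexx ?orbT//
    mulr_ge0// ?exprn_ge0 ?invr_ge0.
- by apply: is_cvg_geometric_series; rewrite ger0_norm ?invr_ge0// invf_lt1// ltr1n.
Qed.

Let seqdistxx x : seqdist x x = 0.
Proof.
rewrite /seqdist (_ : series _ = cst 0) ?lim_cst//.
apply/funext => n; rewrite /series/= big1// => i _.
by rewrite /seqdist_term mdistxx min_l// mulr0.
Qed.

Lemma seqdist_term_le_seqdist x y n : seqdist_term x y n <= seqdist x y.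
Proof.
apply: (@le_trans _ _ (series (seqdist_term x y) n.+1)).
  by rewrite /series/= big_nat_recr//= lerDr sumr_ge0.
apply: nondecreasing_cvgn_le => //.
by apply: nondecreasing_series => i _ _; exact: seqdist_term_ge0.
Qed.

Let seqdist_positivity x y : seqdist x y = 0 -> x = y.
Proof.
move=> xy0; apply/funext => n; apply/(@mdist_positivity R).
have := seqdist_term_le_seqdist x y n; rewrite xy0.
rewrite /seqdist_term pmulr_rle0 ?exprn_gt0 ?invr_gt0// ge_min ler10 orbF => d0.
by apply/eqP; rewrite eq_le d0 mdist_ge0.
Qed.

Let seqdist_sym x y : seqdist x y = seqdist y x.
Proof.
rewrite /seqdist (_ : seqdist_term x y = seqdist_term y x)//.
by apply/funext => n; rewrite /seqdist_term metric_sym.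
Qed.

Let seqdist_triangle y x z : seqdist x z <= seqdist x y + seqdist y z.
Proof.
rewrite /seqdist -limD; [|exact: is_cvg_seqdist..].
apply: ler_lim; [exact: is_cvg_seqdist| |].
  by apply: is_cvgD; exact: is_cvg_seqdist.
apply: nearW => n.
rewrite [leRHS](_ : _ = \sum_(0 <= i < n)
  (seqdist_term x y i + seqdist_term y z i)); last by rewrite big_split.
apply: ler_sum => i _; rewrite /seqdist_term.
rewrite -mulrDr ler_wpM2l ?exprn_ge0 ?invr_ge0//.
have d0 a b : 0 <= mdist a b :> R := @mdist_ge0 R E a b.
have := metric_triangle (x i) (y i) (z i).
by rewrite /Num.min; do 3 case: ifPn; rewrite -?leNgt; move: (d0 (x i) (y i))
  (d0 (y i) (z i)) => *; lra.
Qed.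

HB.instance Definition _ := @isMetric.Build R (seqspace E) seqdist
  seqdistxx seqdist_positivity seqdist_sym seqdist_triangle.

End seqspace_metric.

HB.instance Definition _ (R : realType) (E : completeMetricType R) :=
  Pointed.on (seqspace E).

Definition fstcoord (E : Type) (x : seqspace E) : E := x 0%N.

Lemma fstcoord_continuous (R : realType) (E : metricType R) :
  continuous (@fstcoord E : seqspace E -> E).
Proof.
move=> x.
apply/(metricType_numDomainType.cvgrPdist_lt (FF := nbhs_filter x)) => e e0.
have m0 : 0 < Num.min e 1 by rewrite lt_min e0 ltr01.
have d0 : 0 < 2^-1 * Num.min e 1 by rewrite mulr_gt0// invr_gt0.
apply: filterS (nbhsx_ballx x _ d0) => y; rewrite ballEmdist/= => xy.
have : 2^-1 * Num.min (mdist (x 0%N) (y 0%N)) 1 <= mdist x y.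
  have := @seqdist_term_le_seqdist R E x y 0%N.
  by rewrite {1}/seqdist_term expr1.
move=> /le_lt_trans /(_ xy); rewrite ltr_pM2l ?invr_gt0//.
rewrite lt_min !gt_min ltxx orbF => /andP[/orP[//|e1] d1].
exact: lt_trans d1 e1.
Qed.

Lemma continuous_borel_measurable (S T : ptopologicalType) (g : S -> T) :
  continuous g -> measurable_fun [set: borel S] (g : borel S -> borel T).
Proof.
move=> /continuousP cg.
apply: (@measurability _ _ (borel S) (borel T) setT g (@open T)) => //.
move=> _ [B oB <-]; rewrite setTI.
by apply: sub_sigma_algebra; exact: cg.
Qed.

HB.instance Definition _ (R : realType) (E : completeMetricType R) :=
  @isMeasurableFun.Build _ _ (borel (seqspace E)) (borel E)
    (@fstcoord E : borel (seqspace E) -> borel E)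
    (continuous_borel_measurable (@fstcoord_continuous R E)).

Section ruelle.
Context {R : realType} {E : completeMetricType R}.
Implicit Types (f phi : seqspace E -> R) (p : probability (borel E) R).

Definition scons (a : E) (x : seqspace E) : seqspace E :=
  fun n => if n is m.+1 then x m else a.

Definition Hol (alpha : R) : set (seqspace E -> R) :=
  [set f | [/\ continuous f, bounded_fun f &
    has_ubound [set `|f xy.1 - f xy.2| / mdist xy.1 xy.2 `^ alpha |
                 xy in [set xy : seqspace E * seqspace E | xy.1 != xy.2]]]].

Definition ruelle p f phi (x : seqspace E) : R :=
  \int[p]_(a in [set: borel E]) (expR (f (scons a x)) * phi (scons a x)).

Definition bounded_measurable phi :=
  measurable_fun [set: borel (seqspace E)] phi /\ bounded_fun phi.

(* [ruelle_dual p f mu mu'] means L_f^* mu = mu'. *)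
Definition ruelle_dual p f (mu mu' : probability (borel (seqspace E)) R) :=
  forall phi, bounded_measurable phi ->
    \int[mu']_(x in [set: borel (seqspace E)]) phi x =
    \int[mu]_(x in [set: borel (seqspace E)]) ruelle p f phi x.

Definition depends_on_first_two f :=
  forall x y : seqspace E, x 0%N = y 0%N -> x 1%N = y 1%N -> f x = f y.

End ruelle.

(* Main.v *)
Require Import Defs.
From HB Require Import structures.
From mathcomp Require Import all_boot all_order all_algebra.
From mathcomp Require Import all_classical all_reals all_analysis.
From mathcomp Require Import measurable_realfun lra.

Set Implicit Arguments.
Unset Strict Implicit.
Unset Printing Implicit Defensive.

Import Order.TTheory GRing.Theory Num.Theory.
Import numFieldNormedType.Exports.

Local Open Scope classical_set_scope.
Local Open Scope ring_scope.

(** Freezing the tail of a point at its first coordinate gives the candidate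
    kernel: P(u, A) is the integral over A of exp f(a, u, u, ...) dp(a).  Since
    f only sees two coordinates, P(x_1, A) is the value at x of the Ruelle
    operator on the indicator of the cylinder of points whose first coordinate
    is in A, and total mass 1 is the normalization of f.  Invariance is then the
    fixed point equation for nu tested against that indicator, because the
    integral of P(., A) against the law of x_1 under nu is the nu-integral of
    x |-> P(x_1, A).

    The point that needs an argument is the measurability of u |-> P(u, A).
    Rather than prove joint measurability of the density, one shows that this
    function is continuous.  The Hoelder condition gives the functions
    u |-> f(a, u, u, ...) a modulus of continuity independent of a
    ([Hol_scons_equicontinuous]); so for u close to v the two densities differ
    by a factor at most 1 + e, which passes to the integrals:
    P(u, A) <= (1 + e) P(v, A) and symmetrically.  As P <= 1 this is an additive
    bound by e ([measurable_integral_expR_scons]). *)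

(** * Kernels with a density *)

Section density_kernel.
Context d d' (X : measurableType d) (Y : measurableType d') (R : realType).
Context (mu : {measure set Y -> \bar R}) (w : X -> Y -> \bar R).
Local Open Scope ereal_scope.

Definition density_kernel (x : X) (A : set Y) : \bar R :=
  \int[mu]_(y in A) w x y.

Hypothesis w_ge0 : forall x y, 0 <= w x y.
Hypothesis measurable_w : forall x, measurable_fun [set: Y] (w x).

Let density_kernel0 x : density_kernel x set0 = 0.
Proof. by rewrite /density_kernel integral_set0. Qed.

Let density_kernel_ge0 x A : 0 <= density_kernel x A.
Proof. by apply: integral_ge0. Qed.

Let density_kernel_sigma_additive x : semi_sigma_additive (density_kernel x).
Proof. exact: semi_sigma_additive_nng_induced. Qed.

Definition density_measure (x : X) : {measure set Y -> \bar R} :=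
  HB.pack (density_kernel x) (isMeasure.Build _ _ _ (density_kernel x)
    (density_kernel0 x) (density_kernel_ge0 x)
    (@density_kernel_sigma_additive x)).

Lemma ex_density_kernel :
    (forall x, \int[mu]_y w x y = 1) ->
    (forall A, measurable A -> measurable_fun [set: X] (density_kernel ^~ A)) ->
  exists P : R.-pker X ~> Y, forall x A, P x A = \int[mu]_(y in A) w x y.
Proof.
move=> w1 mw.
pose k1 := isKernel.Build _ _ X Y R density_measure mw.
pose K : R.-ker X ~> Y := HB.pack density_measure k1.
pose k2 := Kernel_isProbability.Build _ _ X Y R K w1.
pose P : R.-pker X ~> Y := HB.pack (K : X -> {measure set Y -> \bar R}) k1 k2.
by exists P.
Qed.

End density_kernel.

(** * Metric estimates on the sequence space *)

(** Measurability of a real-valued map refers to the sigma-algebra generated by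
    half-open intervals, which open intervals generate as well; hence a
    statement distinct from [continuous_borel_measurable]. *)
Lemma continuous_borel_measurable_real (R : realType)
    (S : ptopologicalType) (g : S -> R) :
  continuous g -> measurable_fun [set: borel S] g.
Proof.
move=> /continuousP cg.
apply: (measurability _ (RGenOpens.measurableE R)) => //.
move=> _ [_ [a [b ->] <-]]; rewrite setTI.
by apply: sub_sigma_algebra; exact/cg/interval_open.
Qed.

(** The weights 2^-n, n >= 1, sum to 1. *)
Lemma seqspace_mdist_le (R : realType) (E : metricType R) (x y : seqspace E)
    (r : R) :
  (forall n, mdist (x n) (y n) <= r) -> mdist x y <= r.
Proof.
move=> xyr; rewrite [leLHS](_ : _ = seqdist x y)//.
have r0 : 0 <= r by exact: le_trans (mdist_ge0 _ _) (xyr 0%N).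
have h0 n : 0 <= 2^-1 ^+ n :> R by rewrite exprn_ge0// invr_ge0.
have partial n : series (seqdist_term x y) n <= r.
  (* the n-th partial sum of the weights is 1 - 2^-n *)
  suff: series (seqdist_term x y) n <= (1 - 2^-1 ^+ n) * r.
    by move=> /le_trans; apply; rewrite ler_piMl// gerBl.
  elim: n => [|n IHn]; first by rewrite /series/= big_nil expr0 subrr mul0r.
  rewrite /series/= big_nat_recr//=.
  have : seqdist_term x y n <= 2^-1 ^+ n.+1 * r.
    by rewrite /seqdist_term ler_wpM2l// ge_min xyr.
  move: IHn; rewrite /series/= exprS; lra.
apply: limr_le; last exact: nearW.
apply: nondecreasing_is_cvgn; last by exists r => _ [n _ <-].
apply: nondecreasing_series => n _ _.
by rewrite mulr_ge0// le_min mdist_ge0 ler01.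
Qed.

Section scons_estimates.
Context {R : realType} {E : completeMetricType R}.
Implicit Types (x y : seqspace E) (a b u v : E).

Lemma scons_continuous x : continuous (fun a => scons a x).
Proof.
move=> a.
apply/(metricType_numDomainType.cvgrPdist_lt (FF := nbhs_filter a)) => e e0.
apply: filterS (nbhsx_ballx a _ e0) => b; rewrite ballEmdist/=.
apply: le_lt_trans; apply: seqspace_mdist_le => -[//|n].
by rewrite mdistxx mdist_ge0.
Qed.

Lemma mdist_scons_cst a u v :
  mdist (scons a (fun=> u)) (scons a (fun=> v)) <= mdist u v :> R.
Proof. by apply: seqspace_mdist_le => -[|//]; rewrite mdistxx mdist_ge0. Qed.

Lemma HolP (alpha : R) (f : seqspace E -> R) : Hol alpha f ->
  exists2 C, 0 <= C & forall x y, `|f x - f y| <= C * mdist x y `^ alpha.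
Proof.
move=> [_ _ [C ubC]]; exists `|C| => // x y.
have [->|xy] := eqVneq x y; first by rewrite subrr normr0 mulr_ge0// powR_ge0.
rewrite -ler_pdivrMr ?powR_gt0 ?mdist_gt0//.
by rewrite (le_trans _ (ler_norm C))//; apply: ubC; exists (x, y).
Qed.

(** The modulus r does not depend on a, since prepending a common letter a does
    not increase distances. *)
Lemma Hol_scons_equicontinuous (alpha : R) (f : seqspace E -> R) :
    0 < alpha -> Hol alpha f -> forall t : R, 0 < t ->
  exists2 r : R, 0 < r & forall a u v, mdist u v < r ->
    f (scons a (fun=> u)) <= t + f (scons a (fun=> v)).
Proof.
move=> alpha0 /HolP[C C0 fC] t t0.
have C1 : 0 < C + 1 by rewrite ltr_wpDl.
have tC : 0 < t / (C + 1) by rewrite divr_gt0.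
(* r is chosen so that C * r `^ alpha = C * t / (C + 1) <= t *)
exists ((t / (C + 1)) `^ alpha^-1) => [|a u v uvr]; first exact: powR_gt0.
rewrite -lerBlDr (le_trans (ler_norm _))// (le_trans (fC _ _))//.
rewrite (@le_trans _ _ (C * (t / (C + 1))))//.
  rewrite ler_wpM2l// (@le_trans _ _ (mdist u v `^ alpha))//.
    by rewrite ge0_ler_powR ?nnegrE ?mdist_ge0 ?mdist_scons_cst ?ltW.
  have -> : t / (C + 1) = ((t / (C + 1)) `^ alpha^-1) `^ alpha.
    by rewrite -powRrM mulVf ?lt0r_neq0// powRr1 ?ltW.
  by rewrite ge0_ler_powR ?nnegrE ?mdist_ge0 ?powR_ge0 ?ltW.
by rewrite mulrCA ler_piMr ?ltW// ltr_pdivrMr// mul1r ltrDl.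
Qed.

End scons_estimates.

(** * The kernel of a normalized potential *)

Section transition_kernel.
Context {R : realType} {E : completeMetricType R}.
Variables (p : probability (borel E) R) (f : seqspace E -> R).
Hypothesis f_cont : continuous f.

Lemma measurable_expR_scons x :
  measurable_fun [set: borel E] (fun a : borel E => (expR (f (scons a x)))%:E).
Proof.
apply/measurable_EFinP; apply: continuous_borel_measurable_real => a.
apply: (@continuous_comp _ _ _ (fun b : E => f (scons b x)) (@expR R));
  last exact: continuous_expR.
apply: (@continuous_comp _ _ _ (fun b : E => scons b x) f); last exact: f_cont.
exact: scons_continuous.
Qed.

Lemma ruelle_indic (A : set (borel E)) x : measurable A ->
  ruelle p f (\1_A \o @fstcoord E) x =
  fine (\int[p]_(a in A) (expR (f (scons a x)))%:E)%E.
Proof.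
move=> mA; rewrite /ruelle /Rintegral [in RHS]integral_mkcond; congr fine.
apply: eq_integral => a _ /=.
rewrite patchE indicE /fstcoord/=; case: ifPn => aA; first by rewrite mulr1.
by rewrite mulr0.
Qed.

Hypothesis f_norm : ruelle p f (cst 1) = cst 1.

(** Normalization is an equality of real-valued integrals, where an infinite
    integral counts as 0; the value 1 thus excludes an infinite one. *)
Lemma integral_expR_scons x :
  (\int[p]_(a in [set: borel E]) (expR (f (scons a x)))%:E = 1)%E.
Proof.
have := congr1 (@^~ x) f_norm; rewrite /ruelle /Rintegral/=.
under eq_integral do rewrite mulr1.
by case: (integral _ _ _) => [r /= ->//||] /= /esym/eqP; rewrite oner_eq0.
Qed.

Lemma integral_expR_scons_itv01 x (A : set (borel E)) : measurable A ->
  (0 <= \int[p]_(a in A) (expR (f (scons a x)))%:E <= 1)%E.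
Proof.
move=> mA; rewrite integral_ge0/= => [|a _]; last by rewrite lee_fin expR_ge0.
rewrite -(integral_expR_scons x); apply: ge0_subset_integral => //.
exact: measurable_expR_scons.
Qed.

Lemma integral_expR_scons_fin_num x (A : set (borel E)) : measurable A ->
  (\int[p]_(a in A) (expR (f (scons a x)))%:E)%E \is a fin_num.
Proof.
move=> /(integral_expR_scons_itv01 x)/andP[w0 w1].
by rewrite ge0_fin_numE// (le_lt_trans w1) ?ltry.
Qed.

(** Comparing densities by their ratio makes the integral over A vary by a
    factor at most 1 + e between nearby points, so that it is continuous. *)
Lemma measurable_integral_expR_scons (alpha : R) (A : set (borel E)) :
  0 < alpha -> Hol alpha f -> measurable A ->
  measurable_fun [set: borel E] (fun u : borel E =>
    \int[p]_(a in A) (expR (f (scons a (fun=> u))))%:E)%E.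
Proof.
move=> alpha0 fHol mA.
pose I (u : E) : \bar R :=
  (\int[p]_(a in A) (expR (f (scons a (fun=> u))))%:E)%E.
have Ifin u : I u = (fine (I u))%:E.
  by rewrite fineK// integral_expR_scons_fin_num.
rewrite [X in measurable_fun _ X](_ : _ = EFin \o (fine \o I)); last first.
  by apply/funext => u; exact: Ifin.
apply/measurable_EFinP; apply: continuous_borel_measurable_real => u.
apply/cvgrPdist_le => e e0.
have e1 : 1 < 1 + e by rewrite ltrDl.
(* ln (1 + e) bounds the variation of f, hence 1 + e the density ratio *)
have [r r0 fr] := Hol_scons_equicontinuous alpha0 fHol (ln_gt0 e1).
have Ir v1 v2 : mdist v1 v2 < r -> fine (I v1) <= (1 + e) * fine (I v2).
  move=> v12; rewrite -lee_fin EFinM -!Ifin /I -ge0_integralZl//=.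
  - apply: ge0_le_integral => //=.
    + by apply: measurable_funTS; exact: measurable_expR_scons.
    + apply: measurable_funeM.
      by apply: measurable_funTS; exact: measurable_expR_scons.
    + move=> a _; rewrite lee_fin -[1 + e]lnK ?posrE ?(lt_trans ltr01)//.
      by rewrite -expRD ler_expR fr.
  - by apply: measurable_funTS; exact: measurable_expR_scons.
  - by rewrite lee_fin addr_ge0 ?ltW.
have I01 v : 0 <= fine (I v) <= 1.
  by rewrite -!lee_fin -Ifin integral_expR_scons_itv01.
apply: filterS (nbhsx_ballx u _ r0) => v; rewrite ballEmdist/= => uv.
have := Ir _ _ uv; have := Ir v u; rewrite metric_sym => /(_ uv).
have /andP[? ?] := I01 u; have /andP[? ?] := I01 v.
by rewrite ler_distl => ? ?; apply/andP; split; nra.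
Qed.

End transition_kernel.

Theorem mainTheorem9 (R : realType) (E : completeMetricType R)
    (sepE : separable E) (p : probability (borel E) R)
    (alpha : R) (alpha01 : 0 < alpha < 1)
    (f : seqspace E -> R) (fHol : Hol alpha f)
    (fnorm : ruelle p f (cst 1) = cst 1)
    (f2 : depends_on_first_two f)
    (nu : probability (borel (seqspace E)) R)
    (nufix : ruelle_dual p f nu nu) :
  exists P : R.-pker borel E ~> borel E,
    (forall (x : seqspace E) (A : set (borel E)), measurable A ->
       P (fstcoord x) A = (ruelle p f (\1_A \o @fstcoord E) x)%:E) /\
    (forall A : set (borel E), measurable A ->
       (\int[distribution nu (@fstcoord E)]_(x1 in [set: borel E]) P x1 A =
        distribution nu (@fstcoord E) A)%E).
Proof.
have alpha0 : 0 < alpha by case/andP: alpha01.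
have fcont : continuous f by case: fHol.
pose w (u a : borel E) : \bar R := (expR (f (scons a (fun=> u))))%:E.
have [P PE] : exists P : R.-pker borel E ~> borel E,
    forall u A, P u A = (\int[p]_(a in A) w u a)%E.
  apply: ex_density_kernel.
  - by move=> u a; rewrite lee_fin expR_ge0.
  - by move=> u; exact: measurable_expR_scons.
  - by move=> u; exact: integral_expR_scons.
  - by move=> A mA; exact: measurable_integral_expR_scons alpha0 fHol mA.
have Pruelle (x : seqspace E) (A : set (borel E)) : measurable A ->
    P (fstcoord x) A = (ruelle p f (\1_A \o @fstcoord E) x)%:E.
  move=> mA; rewrite PE ruelle_indic//.
  rewrite fineK; last exact: integral_expR_scons_fin_num.
  apply: eq_integral => a _; congr (expR _)%:E; exact: f2.
exists P; split => // A mA.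
have mX : measurable_fun [set: borel (seqspace E)] (@fstcoord E : _ -> borel E).
  exact: measurable_funPT.
have mP : measurable_fun [set: borel E] (P ^~ A) by exact: measurable_kernel.
rewrite ge0_integral_distribution//.
have int_indic : (\int[nu]_x ((\1_A \o @fstcoord E) x)%:E =
    distribution nu (@fstcoord E) A)%E.
  rewrite (_ : (fun x => _) = EFin \o \1_(@fstcoord E @^-1` A))//.
  rewrite integral_indic ?setIT//.
  by rewrite -[X in measurable X]setTI; exact: mX.
have bm : bounded_measurable (\1_A \o @fstcoord E : seqspace E -> R).
  split; first exact: measurableT_comp (measurable_indic mA) mX.
  exists 1; split => // M M1 x _ /=; rewrite (le_trans _ (ltW M1))//.
  by rewrite indicE; case: (_ \in _); rewrite ?normr1 ?normr0.
have := nufix _ bm; rewrite /Rintegral int_indic.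
under [in RHS]eq_integral do rewrite -Pruelle//.
(* the fixed point equation compares [fine] values; both integrals are finite,
   the left-hand one because the kernel is at most 1 *)
move=> fine_eq; rewrite -[RHS]fineK ?fin_num_measure// fine_eq fineK//.
rewrite ge0_fin_numE ?integral_ge0//.
apply: (@le_lt_trans _ _ (\int[nu]_x (cst 1 x))%E); last first.
  by rewrite integral_cst// mul1e -ge0_fin_numE// fin_num_measure.
apply: ge0_le_integral => //=; first exact: measurableT_comp mP mX.
move=> x _; rewrite PE.
by have /andP[] := integral_expR_scons_itv01 fcont fnorm (fun=> fstcoord x) mA.
Qed.
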